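(* Let $\alpha_3$ be the largest constant $c$ such that the logarithmic Sobolev inequality $$\int_{S^{2}} f|\nabla_\sigma\log f|^2\,d\sigma\;\ge\;2c\left[\int_{S^{2}}f\log f\,d\sigma-\left(\int_{S^{2}}f\,d\sigma\right)\log\left(\int_{S^{2}}f\,d\sigma\right)\right]$$ holds for every positive symmetric (smooth) function $f$ on $S^2$. Then $$\alpha_3\;\le\;\min_{t>0}\left[\left(2t^2\sqrt{t}\,\arctan\left(\frac{1}{\sqrt{t}}\right)+\frac{15}{16}\left(t^2+\frac{2t}{3}+\frac15\right)\log\left(\frac{t^2+2t+1}{t^2+\frac{2t}{3}+\frac15}\right)-\frac{120t^2+35t+9}{60}\right)^{-1}\right]\approx 5.8358.$$
   Context: $S^2\subset\mathbb{R}^3$ is the unit sphere with its round metric; $d\sigma$ is the surface measure normalized so that $\int_{S^2}d\sigma=1$; $\nabla_\sigma$ is the spherical (Riemannian) gradient on $S^2$. A function $f$ on $S^2$ is symmetric if $f(\sigma)=f(-\sigma)$ for every $\sigma\in S^2$. *)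

(* Defs.v *)
From Stdlib Require Import Reals.
From Coquelicot Require Import Coquelicot.
Open Scope R_scope.

Definition R3 : Type := (R * R * R)%type.

Definition px (p : R3) : R := fst (fst p).
Definition py (p : R3) : R := snd (fst p).
Definition pz (p : R3) : R := snd p.

Definition dot (p q : R3) : R := px p * px q + py p * py q + pz p * pz q.
Definition antipode (p : R3) : R3 := (- px p, - py p, - pz p).

Definition on_sphere (p : R3) : Prop := dot p p = 1.

(* A function on the sphere is represented by a function on R^3; every notion
   below depends only on its restriction to the sphere. *)

Definition symmetric_on_sphere (f : R3 -> R) : Prop :=
  forall p, on_sphere p -> f p = f (antipode p).

Definition positive_on_sphere (f : R3 -> R) : Prop :=
  forall p, on_sphere p -> 0 < f p.

Definition slice_x (F : R3 -> R) (p : R3) (s : R) : R := F (s, py p, pz p).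
Definition slice_y (F : R3 -> R) (p : R3) (s : R) : R := F (px p, s, pz p).
Definition slice_z (F : R3 -> R) (p : R3) (s : R) : R := F (px p, py p, s).

Definition dx (F : R3 -> R) (p : R3) : R := Derive (slice_x F p) (px p).
Definition dy (F : R3 -> R) (p : R3) : R := Derive (slice_y F p) (py p).
Definition dz (F : R3 -> R) (p : R3) : R := Derive (slice_z F p) (pz p).

(* Meaningful for open [U]: all partial derivatives of order at most [n] exist
   and are continuous on [U]. *)
Fixpoint Cn_on (U : R3 -> Prop) (n : nat) (F : R3 -> R) : Prop :=
  (forall p, U p -> continuous F p) /\
  match n with
  | O => True
  | S m =>
      (forall p, U p ->
         ex_derive (slice_x F p) (px p) /\
         ex_derive (slice_y F p) (py p) /\
         ex_derive (slice_z F p) (pz p)) /\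
      Cn_on U m (dx F) /\ Cn_on U m (dy F) /\ Cn_on U m (dz F)
  end.

(* Smoothness on the embedded submanifold S^2: near each of its points, f is the
   restriction of a C^oo function of three variables. *)
Definition smooth_on_sphere (f : R3 -> R) : Prop :=
  forall p, on_sphere p ->
    exists (U : R3 -> Prop) (F : R3 -> R),
      open U /\ U p /\
      (forall n, Cn_on U n F) /\
      (forall q, U q -> on_sphere q -> F q = f q).

(* [v] is the Riemannian gradient of [f] at [p] for the round metric, i.e. the
   metric induced by [dot]: the tangent vector representing the differential of
   [f] along curves of the sphere through [p]. *)
Definition is_sphere_grad (f : R3 -> R) (p v : R3) : Prop :=
  dot v p = 0 /\
  forall (gamma : R -> R3) (w : R3),
    (forall s, on_sphere (gamma s)) -> gamma 0 = p ->
    is_derive gamma 0 w ->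
    is_derive (fun s => f (gamma s)) 0 (dot v w).

Definition sphere_param (theta phi : R) : R3 :=
  (sin theta * cos phi, sin theta * sin phi, cos theta).

(* Integral against the normalized surface measure: in spherical coordinates
   the area element is |d_theta X x d_phi X| = sin theta, and the total area
   is 4 PI. *)
Definition sphere_int (f : R3 -> R) : R :=
  RInt (fun phi =>
    RInt (fun theta => f (sphere_param theta phi) * sin theta) 0 PI)
    0 (2 * PI) / (4 * PI).

(* [G] is the field grad (log f); it exists and is unique on the sphere for
   every positive smooth [f]. *)
Definition log_sobolev (c : R) : Prop :=
  forall (f : R3 -> R) (G : R3 -> R3),
    smooth_on_sphere f -> positive_on_sphere f -> symmetric_on_sphere f ->
    (forall p, on_sphere p -> is_sphere_grad (fun q => ln (f q)) p (G p)) ->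
    sphere_int (fun p => f p * dot (G p) (G p)) >=
    2 * c * (sphere_int (fun p => f p * ln (f p))
             - sphere_int f * ln (sphere_int f)).

Definition is_largest (P : R -> Prop) (a : R) : Prop :=
  P a /\ forall c, P c -> c <= a.

Definition is_minimum_on (D : R -> Prop) (g : R -> R) (m : R) : Prop :=
  (exists t, D t /\ g t = m) /\ forall t, D t -> m <= g t.

(* Main.v *)
Require Import Defs.
From Stdlib Require Import Reals Lra FunctionalExtensionality Ranalysis5.
From Coquelicot Require Import Coquelicot.
Open Scope R_scope.

(** Testing the inequality on [f = (1 + x^2 z^2)^2], with [x = 1 / sqrt t],
    bounds [alpha3] by the displayed function of [t], which equals
    [x^5 / entropy_num x].  As a function of [x], [entropy_num x / x^5] has
    derivative [slope x / x^6]; dividing [slope'] by its logarithmic coefficient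
    and differentiating once more leaves a rational function with a single sign
    change on [x > 0].  Hence [entropy_num x / x^5] rises and then falls, and its
    maximum lies so close to [54/47] that evaluating [atan] and [ln] there
    determines it to the required accuracy. *)

(** * Monotonicity and sign changes from derivatives *)

Lemma derive_nonneg_le (f df : R -> R) (a b : R) :
  a <= b ->
  (forall x, a <= x <= b -> is_derive f x (df x)) ->
  (forall x, a < x < b -> 0 <= df x) ->
  f a <= f b.
Proof.
intros [Hab | ->] Hd Hpos; [| lra].
destruct (MVT_cor2 f df a b Hab) as [c [Hc Hin]].
- intros c Hc; apply is_derive_Reals, Hd, Hc.
- specialize (Hpos c Hin); nra.
Qed.

Lemma derive_pos_lt (f df : R -> R) (a b : R) :
  a < b ->
  (forall x, a <= x <= b -> is_derive f x (df x)) ->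
  (forall x, a < x < b -> 0 < df x) ->
  f a < f b.
Proof.
intros Hab Hd Hpos.
destruct (MVT_cor2 f df a b Hab) as [c [Hc Hin]].
- intros c Hc; apply is_derive_Reals, Hd, Hc.
- specialize (Hpos c Hin); nra.
Qed.

Lemma derive_nonpos_ge (f df : R -> R) (a b : R) :
  a <= b ->
  (forall x, a <= x <= b -> is_derive f x (df x)) ->
  (forall x, a < x < b -> df x <= 0) ->
  f b <= f a.
Proof.
intros Hab Hd Hneg.
cut (- f a <= - f b); [lra |].
apply (derive_nonneg_le (fun x => - f x) (fun x => - df x)); auto.
- intros x Hx; apply (is_derive_opp f x (df x)), Hd, Hx.
- intros x Hx; specialize (Hneg x Hx); lra.
Qed.

(** [F] climbs from [0] up to [c] and decreases afterwards, so [F b < 0] forces [b] beyond [c]. The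
    intermediate value theorem gives a zero between them (or [c] itself if [F c = 0]), and
    monotonicity on each side fixes the signs. *)
Lemma sign_change_of_derive (F dF : R -> R) (c b : R) :
  0 <= c -> F 0 = 0 ->
  (forall x, 0 <= x -> is_derive F x (dF x)) ->
  (forall x, 0 < x < c -> 0 <= dF x) ->
  (forall x, c < x -> dF x <= 0) ->
  0 < b -> F b < 0 ->
  exists c', c <= c' /\ F c' = 0 /\
    (forall x, 0 < x < c' -> 0 <= F x) /\
    (forall x, c' < x -> F x <= 0).
Proof.
intros Hc H0 Hd Hpos Hneg Hb HFb.
assert (Hleft : forall x, 0 <= x <= c -> 0 <= F x).
{ intros x Hx; rewrite <- H0.
  apply (derive_nonneg_le F dF); [lra | |]; intros z Hz;
    [apply Hd | apply Hpos]; lra. }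
assert (Hright : forall x z, c <= x <= z -> F z <= F x).
{ intros x z Hx.
  apply (derive_nonpos_ge F dF); [lra | |]; intros u Hu;
    [apply Hd | apply Hneg]; lra. }
assert (Hroot : exists c', c <= c' /\ F c' = 0).
{ destruct (Rle_lt_or_eq_dec 0 (F c)) as [Hlt | Heq];
    [apply Hleft; lra | | exists c; lra].
  assert (Hcb : c < b).
  { destruct (Rlt_le_dec c b) as [H | H]; [exact H |].
    assert (0 <= F b) by (apply Hleft; lra); lra. }
  destruct (IVT_interv (fun x => - F x) c b) as [z [Hz Hz0]]; try lra.
  - intros x Hx; apply continuity_pt_opp, derivable_continuous_pt.
    exists (dF x); apply is_derive_Reals, Hd; lra.
  - exists z; lra. }
destruct Hroot as [c' [Hcc' Hc']].
exists c'; repeat split; auto.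
- intros x Hx; destruct (Rle_lt_dec x c); [apply Hleft; lra |].
  rewrite <- Hc'; apply Hright; lra.
- intros x Hx; rewrite <- Hc'; apply Hright; lra.
Qed.

(** * Numerical bounds for [atan] and [ln] *)

(** As a function of [u], the difference of the two sides has derivative zero and vanishes at [0];
    [u * v < 1] keeps the denominator positive on the whole interval. *)
Lemma atan_add (u v : R) :
  0 < u -> 0 < v -> u * v < 1 ->
  atan u + atan v = atan ((u + v) / (1 - u * v)).
Proof.
intros Hu Hv Huv.
cut (atan 0 + atan v - atan ((0 + v) / (1 - 0 * v)) =
     atan u + atan v - atan ((u + v) / (1 - u * v))).
{ replace ((0 + v) / (1 - 0 * v)) with v by field.
  rewrite atan_0; lra. }
apply (eq_is_derive (fun s => atan s + atan v - atan ((s + v) / (1 - s * v))));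
  [| exact Hu].
intros s Hs.
assert (s * v < 1) by nra.
auto_derive; [lra |].
unfold zero; simpl; field; repeat split; try lra; try nra.
Qed.

(** Subtracting the Taylor polynomial leaves a function whose derivative is the remainder of the
    geometric series for [1 / (1 + s^2)], which has a constant sign. *)
Lemma atan_poly_bounds (x : R) :
  0 <= x ->
  x - x^3/3 + x^5/5 - x^7/7 + x^9/9 - x^11/11 <= atan x
  <= x - x^3/3 + x^5/5 - x^7/7 + x^9/9 - x^11/11 + x^13/13.
Proof.
intros Hx; split.
- cut (atan 0 - (0 - 0^3/3 + 0^5/5 - 0^7/7 + 0^9/9 - 0^11/11) <=
       atan x - (x - x^3/3 + x^5/5 - x^7/7 + x^9/9 - x^11/11)).
  { rewrite atan_0; lra. }
  apply (derive_nonneg_le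
    (fun s => atan s - (s - s^3/3 + s^5/5 - s^7/7 + s^9/9 - s^11/11))
    (fun s => s^12 / (1 + s^2))); [exact Hx | |].
  + intros s _; auto_derive; [easy |]; field; apply Rgt_not_eq; nra.
  + intros s Hs; apply Rdiv_le_0_compat; [apply pow_le; lra | nra].
- cut (atan x - (x - x^3/3 + x^5/5 - x^7/7 + x^9/9 - x^11/11 + x^13/13) <=
       atan 0 - (0 - 0^3/3 + 0^5/5 - 0^7/7 + 0^9/9 - 0^11/11 + 0^13/13)).
  { rewrite atan_0; lra. }
  apply (derive_nonpos_ge
    (fun s => atan s - (s - s^3/3 + s^5/5 - s^7/7 + s^9/9 - s^11/11 + s^13/13))
    (fun s => - (s^14 / (1 + s^2)))); [exact Hx | |].
  + intros s _; auto_derive; [easy |]; field; apply Rgt_not_eq; nra.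
  + intros s Hs.
    cut (0 <= s^14 / (1 + s^2)); [lra |].
    apply Rdiv_le_0_compat; [apply pow_le; lra | nra].
Qed.

(** The logarithm is [2 artanh z]. The lower bound truncates its series; the upper one dominates the
    tail by the geometric series [z^13 / 13 * (1 + z^2 + z^4 + ...)]. Both follow from the sign of
    the derivative of the difference. *)
Lemma ln_artanh_bounds (z : R) :
  0 <= z < 1 ->
  2 * (z + z^3/3 + z^5/5 + z^7/7 + z^9/9 + z^11/11) <= ln ((1 + z) / (1 - z))
  <= 2 * (z + z^3/3 + z^5/5 + z^7/7 + z^9/9 + z^11/11 + z^13/(13 * (1 - z^2))).
Proof.
intros Hz.
assert (Hpos : forall s, 0 <= s <= z -> 0 < (1 + s) / (1 - s) /\ 0 < 1 - s^2).
{ intros s Hs; split; [apply Rdiv_lt_0_compat; lra | nra]. }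
assert (Hln0 : ln ((1 + 0) / (1 - 0)) = 0).
{ replace ((1 + 0) / (1 - 0)) with 1 by field; apply ln_1. }
split.
- cut (ln ((1 + 0) / (1 - 0)) - 2 * (0 + 0^3/3 + 0^5/5 + 0^7/7 + 0^9/9 + 0^11/11)
    <= ln ((1 + z) / (1 - z)) - 2 * (z + z^3/3 + z^5/5 + z^7/7 + z^9/9 + z^11/11)).
  { rewrite Hln0; lra. }
  apply (derive_nonneg_le
    (fun s => ln ((1 + s) / (1 - s))
              - 2 * (s + s^3/3 + s^5/5 + s^7/7 + s^9/9 + s^11/11))
    (fun s => 2 * (s^12 / (1 - s^2)))); [lra | |].
  + intros s Hs; destruct (Hpos s Hs); auto_derive; [repeat split; (assumption || lra) |].
    field; repeat split; nra.
  + intros s Hs; destruct (Hpos s) as [_ H]; [lra |].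
    cut (0 <= s^12 / (1 - s^2)); [lra |].
    apply Rdiv_le_0_compat; [apply pow_le; lra | exact H].
- cut (ln ((1 + z) / (1 - z))
       - 2 * (z + z^3/3 + z^5/5 + z^7/7 + z^9/9 + z^11/11 + z^13/(13 * (1 - z^2)))
    <= ln ((1 + 0) / (1 - 0))
       - 2 * (0 + 0^3/3 + 0^5/5 + 0^7/7 + 0^9/9 + 0^11/11 + 0^13/(13 * (1 - 0^2)))).
  { rewrite Hln0; lra. }
  apply (derive_nonpos_ge
    (fun s => ln ((1 + s) / (1 - s))
      - 2 * (s + s^3/3 + s^5/5 + s^7/7 + s^9/9 + s^11/11 + s^13/(13 * (1 - s^2))))
    (fun s => - (4 * s^14 / (13 * (1 - s^2)^2)))); [lra | |].
  + intros s Hs; destruct (Hpos s Hs); auto_derive; [repeat split; (assumption || nra) |].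
    field; repeat split; nra.
  + intros s Hs; destruct (Hpos s) as [_ H]; [lra |].
    cut (0 <= 4 * s^14 / (13 * (1 - s^2)^2)); [lra |].
    assert (0 <= s^14) by (apply pow_le; lra).
    apply Rdiv_le_0_compat; nra.
Qed.

(** * The entropy of the test function and its derivatives *)

(** The average of the test function [(1 + x^2 z^2)^2] over the sphere. *)
Definition mean (x : R) : R := 1 + 2 * x^2 / 3 + x^4 / 5.

Definition logratio (x : R) : R := ln ((1 + x^2)^2 / mean x).

(** For [x > 0] this is [15/16 * x] times the entropy of the test function; the normalization
    removes the denominators of [x] and makes the coefficient of [atan] equal to [2]. *)
Definition entropy_num (x : R) : R :=
  2 * atan x
  + x * (15/16 * mean x * logratio x - 2 - 7 * x^2 / 12 - 3 * x^4 / 20).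

Definition entropy_num' (x : R) : R :=
  15/16 * (1 + x^2)^2 * logratio x - x^2 * (5 + 3 * x^2) / 4.

Definition slope (x : R) : R := x * entropy_num' x - 5 * entropy_num x.

Definition slope_factor (x : R) : R :=
  - (15/4) * logratio x + x^2 * (5 + x^2) / (2 * mean x)
  + 5 * x^2 / (2 * (1 + x^2)).

Lemma mean_pos (x : R) : 0 < mean x.
Proof. unfold mean; nra. Qed.

Lemma mean_lt (x : R) : 0 < x -> mean x < (1 + x^2)^2.
Proof. intros Hx; unfold mean; nra. Qed.

Lemma logratio_0 : logratio 0 = 0.
Proof.
unfold logratio, mean.
replace ((1 + 0^2)^2 / (1 + 2 * 0^2 / 3 + 0^4 / 5)) with 1 by field.
apply ln_1.
Qed.

Lemma is_derive_logratio (x : R) :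
  is_derive logratio x (8 * x * (5 + x^2) / (15 * (1 + x^2) * mean x)).
Proof.
assert (Hm := mean_pos x).
unfold logratio, mean in *.
assert (0 < (1 + x^2)^2) by (apply pow_lt; nra).
auto_derive.
- repeat split; [simpl in *; lra | apply Rdiv_lt_0_compat; simpl in *; lra].
- field; repeat split; nra.
Qed.

(** Differentiates while keeping [logratio] opaque. [auto_derive] leaves an eta-expanded [Derive],
    which is contracted before the known derivative is substituted. *)
Ltac derive_logratio :=
  match goal with |- is_derive _ ?x _ =>
    let H := fresh in
    assert (H := is_derive_logratio x);
    auto_derive;
      [repeat split; try (eexists; exact H); try nra
      | replace (Derive (fun s => logratio s) x)
          with (Derive logratio x) by reflexivity;
        rewrite (is_derive_unique _ _ _ H)]
  end.

Lemma is_derive_entropy_num (x : R) :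
  is_derive entropy_num x (entropy_num' x).
Proof.
assert (Hm := mean_pos x).
unfold entropy_num, entropy_num', mean in *.
derive_logratio.
unfold mean; field; repeat split; nra.
Qed.

(** The logarithmic terms of the derivative add up to [-(15/4) * (1 + x^2) * logratio x], so in
    [slope_factor] the logarithm has a constant coefficient and disappears at the next
    differentiation. *)
Lemma is_derive_slope (x : R) :
  is_derive slope x ((1 + x^2) * slope_factor x).
Proof.
assert (Hm := mean_pos x).
unfold slope.
assert (HN := is_derive_entropy_num x).
assert (HN' : is_derive entropy_num' x
  (15/4 * x * (1 + x^2) * logratio x + x * (1 + x^2) * (5 + x^2) / (2 * mean x)
   - 5 * x / 2 - 3 * x^3)).
{ unfold entropy_num', mean in *; derive_logratio.
  unfold mean; field; repeat split; nra. }
auto_derive; [repeat split; eexists; eassumption |].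
replace (Derive (fun s => entropy_num s) x) with (Derive entropy_num x)
  by reflexivity.
replace (Derive (fun s => entropy_num' s) x) with (Derive entropy_num' x)
  by reflexivity.
rewrite (is_derive_unique _ _ _ HN), (is_derive_unique _ _ _ HN').
unfold entropy_num', slope_factor; field; repeat split; nra.
Qed.

Lemma is_derive_slope_factor (x : R) :
  is_derive slope_factor x
    (8/45 * x^5 * (8 - 3 * (1 + x^2)^2) / ((1 + x^2) * mean x)^2).
Proof.
assert (Hm := mean_pos x).
unfold slope_factor, mean in *.
derive_logratio.
unfold mean; field; repeat split; nra.
Qed.

(** Here [b] is [entropy_num'] divided by [(1 + s^2)^2], which again isolates the logarithm. It
    vanishes at [0] and increases because [mean u < (1 + u^2)^2]; hence [entropy_num] increases from
    [0]. *)
Lemma entropy_num_pos (x : R) : 0 < x -> 0 < entropy_num x.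
Proof.
pose (b := fun s => 15/16 * logratio s - s^2 * (5 + 3 * s^2) / (4 * (1 + s^2)^2)).
assert (Hb : forall s, 0 < s -> 0 < b s).
{ intros s Hs.
  replace 0 with (b 0) by (unfold b; rewrite logratio_0; field).
  apply (derive_pos_lt b
    (fun u => u * (5 + u^2) / (2 * (1 + u^2)) * (/ mean u - / (1 + u^2)^2)));
    [exact Hs | |].
  - intros u _; unfold b.
    assert (Hm := mean_pos u); unfold mean in *.
    assert (0 < 1 + u^2) by nra.
    derive_logratio.
    + unfold mean; field; repeat split; nra.
  - intros u Hu.
    assert (Hm := mean_pos u).
    apply Rmult_lt_0_compat.
    + apply Rdiv_lt_0_compat; nra.
    + apply Rlt_0_minus, Rinv_lt_contravar; [| apply mean_lt; lra].
      apply Rmult_lt_0_compat; [exact Hm | apply pow_lt; nra]. }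
intros Hx.
replace 0 with (entropy_num 0)
  by (unfold entropy_num; rewrite atan_0; ring).
apply (derive_pos_lt entropy_num entropy_num'); [exact Hx | |].
- intros s _; apply is_derive_entropy_num.
- intros s Hs.
  replace (entropy_num' s) with ((1 + s^2)^2 * b s)
    by (unfold entropy_num', b; field; nra).
  apply Rmult_lt_0_compat; [apply pow_lt; nra | apply Hb; lra].
Qed.

(** * Evaluation near the maximizer *)

(* [5/23] and [14/9] below are chosen so that [4 * atan (5/23)] and
   [2 * ln (14/9)] are within [0.002] of the required values. *)
Lemma atan_54_47 : 0.854594440 <= atan (54/47) <= 0.854594444.
Proof.
assert (H2 : atan (5/23) + atan (5/23) = atan (115/252)).
{ rewrite atan_add; [f_equal; field | lra..]. }
assert (H4 : atan (115/252) + atan (115/252) = atan (57960/50279)).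
{ rewrite atan_add; [f_equal; field | lra..]. }
(* The small angle is the exact excess of [4 * atan (5/23)] over [atan (54/47)], found from the
   tangent subtraction formula. *)
assert (Hw : atan (54/47) + atan (9054/5492953) = atan (57960/50279)).
{ rewrite atan_add; [f_equal; field | lra..]. }
assert (B1 := atan_poly_bounds (5/23)).
assert (B2 := atan_poly_bounds (9054/5492953)).
lra.
Qed.

Lemma logratio_54_47 : 0.881832339 <= logratio (54/47) <= 0.881832342.
Proof.
(* [z] solves [(1 + z) / (1 - z) = (14/9)^2 / r], where [r] is the argument of the logarithm in
   [logratio (54/47)]. *)
pose (z := 19518311/21294674561).
assert (E : logratio (54/47)
            = 2 * ln ((1 + 5/23) / (1 - 5/23)) - ln ((1 + z) / (1 - z))).
{ replace (2 * ln ((1 + 5/23) / (1 - 5/23)))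
    with (ln ((14/9) * (14/9))).
  - rewrite <- ln_div; [| lra | unfold z; lra].
    unfold logratio, mean, z; f_equal; field.
  - rewrite ln_mult by lra.
    replace ((1 + 5/23) / (1 - 5/23)) with (14/9) by field; ring. }
assert (B1 := ln_artanh_bounds (5/23)).
assert (B2 := ln_artanh_bounds z).
rewrite E; unfold z in *; lra.
Qed.

(** Negativity puts [54/47] to the right of the maximizer; the lower bound controls how far the
    ratio can have dropped by then. *)
Lemma slope_54_47 : - 0.0000012 <= slope (54/47) < 0.
Proof.
assert (HA := atan_54_47); assert (HL := logratio_54_47).
unfold slope, entropy_num', entropy_num, mean; lra.
Qed.

(** The margin [0.000002] absorbs the gap between the value at [54/47] and the true maximum. *)
Lemma entropy_num_54_47 :
  / 5.8359 < entropy_num (54/47) / (54/47)^5 <= / 5.8358 - 0.000002.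
Proof.
assert (HA := atan_54_47); assert (HL := logratio_54_47).
unfold entropy_num, mean; lra.
Qed.

Lemma slope_factor_54_47 : slope_factor (54/47) < 0.
Proof.
assert (HL := logratio_54_47).
unfold slope_factor, mean; lra.
Qed.

(** * The maximum of the entropy ratio *)

Lemma is_derive_entropy_ratio (x : R) :
  0 < x -> is_derive (fun s => entropy_num s / s^5) x (slope x / x^6).
Proof.
intros Hx.
assert (HN := is_derive_entropy_num x).
auto_derive.
- repeat split; [eexists; exact HN | apply (pow_nonzero x 5); lra].
- replace (Derive (fun s => entropy_num s) x) with (Derive entropy_num x)
    by reflexivity.
  rewrite (is_derive_unique _ _ _ HN); unfold slope; field; lra.
Qed.

(* Both [slope_factor] and [slope] vanish at [0], rise and then fall: the sign
   change of the explicit rational [slope_factor'] is inherited twice. *)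
Lemma entropy_ratio_max :
  exists c, 0 < c /\
    (forall x, 0 < x -> entropy_num x / x^5 <= entropy_num c / c^5) /\
    / 5.8359 < entropy_num c / c^5 <= / 5.8358.
Proof.
assert (HQ : forall x, 0 < ((1 + x^2) * mean x)^2).
{ intros x; apply pow_lt, Rmult_lt_0_compat; [nra | apply mean_pos]. }
assert (Hs83 : 1.63 < sqrt (8/3)).
{ rewrite <- (sqrt_pow2 1.63) by lra; apply sqrt_lt_1_alt; lra. }
assert (Hs83' : sqrt (8/3) * sqrt (8/3) = 8/3) by (apply sqrt_sqrt; lra).
(* The positive root of [3 * (1 + x^2)^2 = 8], where the derivative of [slope_factor] changes
   sign. *)
pose (c0 := sqrt (sqrt (8/3) - 1)).
assert (Hc0 : c0 * c0 = sqrt (8/3) - 1) by (apply sqrt_sqrt; lra).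
assert (Hc0' : 0 <= c0) by apply sqrt_pos.
destruct (sign_change_of_derive slope_factor
  (fun x => 8/45 * x^5 * (8 - 3 * (1 + x^2)^2) / ((1 + x^2) * mean x)^2)
  c0 (54/47)) as [c1 [Hc1 [_ [Hpos1 Hneg1]]]].
- exact Hc0'.
- unfold slope_factor, mean; rewrite logratio_0; field.
- intros x _; apply is_derive_slope_factor.
- intros x Hx; apply Rdiv_le_0_compat; [| apply HQ].
  apply Rmult_le_pos.
  + assert (0 <= x^5) by (apply pow_le; lra); lra.
  + assert (x * x <= c0 * c0) by nra.
    assert ((1 + x^2) * (1 + x^2) <= sqrt (8/3) * sqrt (8/3))
      by (apply Rmult_le_compat; nra).
    nra.
- intros x Hx.
  cut (0 <= 8/45 * x^5 * (3 * (1 + x^2)^2 - 8) / ((1 + x^2) * mean x)^2).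
  { intros H.
    replace (8/45 * x^5 * (8 - 3 * (1 + x^2)^2) / ((1 + x^2) * mean x)^2)
      with (- (8/45 * x^5 * (3 * (1 + x^2)^2 - 8) / ((1 + x^2) * mean x)^2))
      by (field; split; [apply Rgt_not_eq, mean_pos | nra]).
    lra. }
  apply Rdiv_le_0_compat; [| apply HQ].
  apply Rmult_le_pos.
  + assert (0 <= x^5) by (apply pow_le; lra); lra.
  + assert (c0 * c0 <= x * x) by nra.
    assert (sqrt (8/3) * sqrt (8/3) <= (1 + x^2) * (1 + x^2))
      by (apply Rmult_le_compat; nra).
    nra.
- lra.
- apply slope_factor_54_47.
(* From [c1 >= c0] and [sqrt (8/3) > 1.63]. The bound passes on to [c >= c1], where it yields
   [c >= 0.79] and [s^6 >= 1/4]. *)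
- assert (Hc1' : 0.63 <= c1 * c1) by nra.
  destruct (sign_change_of_derive slope
    (fun x => (1 + x^2) * slope_factor x) c1 (54/47))
    as [c [Hc [Hc' [Hpos Hneg]]]].
  + lra.
  + unfold slope, entropy_num; rewrite atan_0; ring.
  + intros x _; apply is_derive_slope.
  + intros x Hx; specialize (Hpos1 x Hx); nra.
  + intros x Hx; specialize (Hneg1 x Hx); nra.
  + lra.
  + apply slope_54_47.
  + assert (Hc2 : 0.63 <= c^2) by nra.
    assert (Hcpos : 0 < c) by nra.
    assert (Hca : c <= 54/47).
    { destruct (Rle_lt_dec c (54/47)) as [H | H]; [exact H |].
      assert (0 <= slope (54/47)) by (apply Hpos; lra).
      destruct slope_54_47; lra. }
    assert (Hmax : forall x, 0 < x ->
      entropy_num x / x^5 <= entropy_num c / c^5).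
    { intros x Hx; destruct (Rle_lt_dec x c) as [Hxc | Hxc].
      - apply (derive_nonneg_le (fun s => entropy_num s / s^5)
          (fun s => slope s / s^6)); [exact Hxc | |]; intros s Hs.
        + apply is_derive_entropy_ratio; lra.
        + apply Rdiv_le_0_compat; [apply Hpos | apply pow_lt]; lra.
      - apply (derive_nonpos_ge (fun s => entropy_num s / s^5)
          (fun s => slope s / s^6)); [lra | |]; intros s Hs.
        + apply is_derive_entropy_ratio; lra.
        + assert (Hs' : slope s <= 0) by (apply Hneg; lra).
          assert (0 < / s^6) by (apply Rinv_0_lt_compat, pow_lt; lra).
          unfold Rdiv; nra. }
    destruct entropy_num_54_47 as [Hlow Hup].
    exists c; repeat split; [exact Hcpos | exact Hmax | |].
    * apply (Rlt_le_trans _ _ _ Hlow), Hmax; lra.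
    (* On [c, 54/47] the slope is at least [-0.0000012] and [s^6 >= 1/4], so the
       ratio drops by at most [0.0000048 * (54/47 - c)]. *)
    * cut (entropy_num c / c^5 + 0.0000048 * c
           <= entropy_num (54/47) / (54/47)^5 + 0.0000048 * (54/47)).
      { assert (0.79 <= c) by nra; lra. }
      apply (derive_nonneg_le (fun s => entropy_num s / s^5 + 0.0000048 * s)
        (fun s => slope s / s^6 + 0.0000048)); [exact Hca | |]; intros s Hs.
      -- apply (is_derive_plus (fun s => entropy_num s / s^5)
           (fun s => 0.0000048 * s)).
         ++ apply is_derive_entropy_ratio; lra.
         ++ auto_derive; [easy | ring].
      (* Beyond [c1] the factor is nonpositive, so [slope] decreases and its least value on
         [[c, 54/47]] is at the right end. *)
      -- assert (Hs1 : slope (54/47) <= slope s).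
         { apply (derive_nonpos_ge slope (fun x => (1 + x^2) * slope_factor x));
             [lra | |]; intros u Hu.
           - apply is_derive_slope.
           - specialize (Hneg1 u); nra. }
         destruct slope_54_47 as [Hs2 _].
         assert (Hs6 : 0.25 <= s^6).
         { assert (0.63 <= s^2) by nra.
           assert (0.63^3 <= (s^2)^3) by (apply pow_incr; lra).
           replace (s^6) with ((s^2)^3) by ring; lra. }
         replace (slope s / s^6 + 0.0000048)
           with ((slope s + 0.0000048 * s^6) / s^6) by (field; lra).
         apply Rdiv_le_0_compat; lra.
Qed.

(** * Smoothness, integrals and gradients of zonal functions *)

(* A class of functions of [z] closed under all partial derivatives. *)
Definition quartic (a0 a1 a2 a3 a4 : R) (p : R3) : R :=
  a0 + a1 * pz p + a2 * pz p ^ 2 + a3 * pz p ^ 3 + a4 * pz p ^ 4.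

Lemma Cn_on_ext (U : R3 -> Prop) (n : nat) (F F' : R3 -> R) :
  (forall p, F p = F' p) -> Cn_on U n F -> Cn_on U n F'.
Proof.
intros H.
replace F' with F; [easy |].
apply functional_extensionality, H.
Qed.

Lemma quartic_Cn (U : R3 -> Prop) (n : nat) (a0 a1 a2 a3 a4 : R) :
  Cn_on U n (quartic a0 a1 a2 a3 a4).
Proof.
revert a0 a1 a2 a3 a4; induction n as [| n IH]; intros a0 a1 a2 a3 a4;
  (split; [intros p _ |]).
1, 3: apply (continuous_comp (fun q : R3 => snd q)
        (fun s => a0 + a1 * s + a2 * s^2 + a3 * s^3 + a4 * s^4));
      [apply continuous_snd |];
      apply (ex_derive_continuous (K := R_AbsRing) (V := R_NormedModule)
        (fun s => a0 + a1 * s + a2 * s^2 + a3 * s^3 + a4 * s^4) (snd p));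
      auto_derive; easy.
- easy.
- split; [| split; [| split]].
  + intros p _; unfold slice_x, slice_y, slice_z, quartic, pz; simpl.
    repeat split; auto_derive; easy.
  + apply (Cn_on_ext U n (quartic 0 0 0 0 0)); [| apply IH].
    intros p; unfold dx, slice_x, quartic, pz; simpl.
    rewrite Derive_const; ring.
  + apply (Cn_on_ext U n (quartic 0 0 0 0 0)); [| apply IH].
    intros p; unfold dy, slice_y, quartic, pz; simpl.
    rewrite Derive_const; ring.
  + apply (Cn_on_ext U n (quartic a1 (2 * a2) (3 * a3) (4 * a4) 0)); [| apply IH].
    intros p; unfold dz, slice_z; symmetry; apply is_derive_unique.
    unfold quartic, pz; simpl; auto_derive; [easy | ring].
Qed.

(** Substituting [z = cos theta], the inner integrand [h (cos theta) * sin theta] has primitive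
    [- H (cos theta)]; the outer integral contributes [2 * PI], which against [4 * PI] leaves
    [1/2]. *)
Lemma sphere_int_zonal (f : R3 -> R) (h H : R -> R) :
  (forall p, on_sphere p -> f p = h (pz p)) ->
  (forall z, is_derive H z (h z)) ->
  (forall z, continuous h z) ->
  sphere_int f = (H 1 - H (-1)) / 2.
Proof.
intros Hf HH Hh; unfold sphere_int.
rewrite (RInt_ext _ (fun _ => H 1 - H (-1))).
- rewrite RInt_const; unfold scal; simpl; unfold mult; simpl.
  field; apply PI_neq0.
- intros phi _.
  rewrite (RInt_ext _ (fun theta => h (cos theta) * sin theta)).
  + apply is_RInt_unique.
    replace (H 1 - H (-1)) with (minus (- H (cos PI)) (- H (cos 0)))
      by (rewrite cos_PI, cos_0; unfold minus, plus, opp; simpl; ring).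
    apply (is_RInt_derive (fun theta => - H (cos theta))).
    * intros theta _.
      assert (Hd := HH (cos theta)).
      auto_derive; [eexists; exact Hd |].
      replace (Derive (fun s => H s) (cos theta)) with (Derive H (cos theta))
        by reflexivity.
      rewrite (is_derive_unique _ _ _ Hd); ring.
    * intros theta _; apply (continuous_mult (fun u => h (cos u)) sin).
      -- apply continuous_comp; [apply continuous_cos | apply Hh].
      -- apply continuous_sin.
  + intros theta _; rewrite Hf; [reflexivity |].
    unfold on_sphere, dot, sphere_param, px, py, pz; simpl.
    assert (H1 := sin2_cos2 theta); assert (H2 := sin2_cos2 phi).
    unfold Rsqr in *.
    replace (sin theta * cos phi * (sin theta * cos phi)
             + sin theta * sin phi * (sin theta * sin phi)
             + cos theta * cos theta)
      with (sin theta * sin theta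
              * (sin phi * sin phi + cos phi * cos phi)
            + cos theta * cos theta) by ring.
    rewrite H2; lra.
Qed.

Lemma is_derive_linear {U V : NormedModule R_AbsRing} (l : U -> V) (g : R -> U)
  (s : R) (w : U) :
  is_linear l -> is_derive g s w -> is_derive (fun u => l (g u)) s (l w).
Proof.
intros Hl Hg.
apply (filterdiff_ext_lin _ (fun y : R => l (scal y w)));
  [| intros y; apply (linear_scal l Hl)].
apply (filterdiff_comp' g l s (fun y : R => scal y w) l Hg).
apply filterdiff_linear, Hl.
Qed.

Lemma is_derive_R3 (gamma : R -> R3) (w : R3) (s : R) :
  is_derive gamma s w ->
  is_derive (fun u => px (gamma u)) s (px w) /\
  is_derive (fun u => py (gamma u)) s (py w) /\
  is_derive (fun u => pz (gamma u)) s (pz w).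
Proof.
intros Hg; split; [| split].
- apply (is_derive_linear (V := R_NormedModule) px); [| exact Hg].
  apply (is_linear_comp (fst : R3 -> R * R) (fst : R * R -> R)); apply is_linear_fst.
- apply (is_derive_linear (V := R_NormedModule) py); [| exact Hg].
  apply (is_linear_comp (fst : R3 -> R * R) (snd : R * R -> R));
    [apply is_linear_fst | apply is_linear_snd].
- apply (is_derive_linear (V := R_NormedModule) pz); [apply is_linear_snd | exact Hg].
Qed.

(** Differentiate the constant [dot (gamma u) (gamma u) = 1]. *)
Lemma sphere_velocity_orthogonal (gamma : R -> R3) (w : R3) (s : R) :
  (forall u, on_sphere (gamma u)) -> is_derive gamma s w ->
  dot (gamma s) w = 0.
Proof.
intros Hs Hg.
destruct (is_derive_R3 gamma w s Hg) as [Hx [Hy Hz]].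
assert (H1 : is_derive (fun u => dot (gamma u) (gamma u)) s
               (2 * dot (gamma s) w)).
{ unfold dot.
  evar_last.
  - apply @is_derive_plus; [apply @is_derive_plus |];
      apply @is_derive_mult; try exact Rmult_comm; eassumption.
  - unfold plus, mult; simpl; ring. }
assert (H2 : is_derive (fun u => dot (gamma u) (gamma u)) s 0).
{ apply (is_derive_ext (fun _ => 1)); [| apply @is_derive_const].
  intros u; symmetry; apply Hs. }
apply is_derive_unique in H1; apply is_derive_unique in H2; lra.
Qed.

(* For a function [h (pz p)] the spherical gradient is [h'] times the tangential
   projection [e_z - z p] of [e_z]. *)
Definition zonal_grad (h' : R -> R) (p : R3) : R3 :=
  (- h' (pz p) * pz p * px p, - h' (pz p) * pz p * py p,
   h' (pz p) * (1 - pz p ^ 2)).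

(** The chain rule gives [h' (pz p) * pz w]. The projected field pairs with [w] to the same value,
    since the extra term is a multiple of [dot p w = 0]. *)
Lemma is_sphere_grad_zonal (h h' : R -> R) (p : R3) :
  is_derive h (pz p) (h' (pz p)) -> on_sphere p ->
  is_sphere_grad (fun q => h (pz q)) p (zonal_grad h' p).
Proof.
intros Hh Hp; split.
- replace (dot (zonal_grad h' p) p) with (h' (pz p) * pz p * (1 - dot p p))
    by (unfold zonal_grad, dot, px, py, pz; simpl; ring).
  rewrite Hp; ring.
- intros gamma w Hs H0 Hg.
  assert (Hort := sphere_velocity_orthogonal gamma w 0 Hs Hg).
  destruct (is_derive_R3 gamma w 0 Hg) as [_ [_ Hz]].
  replace (dot (zonal_grad h' p) w)
    with (h' (pz p) * pz w - h' (pz p) * pz p * dot p w)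
    by (unfold zonal_grad, dot, px, py, pz; simpl; ring).
  rewrite H0 in Hort; rewrite Hort.
  replace (h' (pz p) * pz w - h' (pz p) * pz p * 0) with (pz w * h' (pz p))
    by ring.
  apply (is_derive_comp h (fun u => pz (gamma u))); [| exact Hz].
  rewrite H0; exact Hh.
Qed.

Lemma zonal_grad_sq (h' : R -> R) (p : R3) :
  on_sphere p ->
  dot (zonal_grad h' p) (zonal_grad h' p) = h' (pz p) ^ 2 * (1 - pz p ^ 2).
Proof.
unfold on_sphere; intros Hp.
replace (dot (zonal_grad h' p) (zonal_grad h' p))
  with (h' (pz p) ^ 2 * (pz p ^ 2 * dot p p + 1 - 2 * pz p ^ 2))
  by (unfold zonal_grad, dot, px, py, pz; simpl; ring).
rewrite Hp; ring.
Qed.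

(** * The inequality for the test function *)

(** The energy of the test function is [32/15 * x^4] and its entropy is [16/15 * entropy_num x / x];
    clearing the common factor gives the bound. *)
Lemma log_sobolev_entropy_num (c x : R) :
  log_sobolev c -> 0 < x -> c * entropy_num x <= x^5.
Proof.
intros Hc Hx.
pose (f := quartic 1 0 (2 * x^2) 0 (x^4)).
pose (h' := fun z => 4 * x^2 * z / (1 + x^2 * z^2)).
assert (Hw : forall z, 0 < 1 + x^2 * z^2).
{ intros z; assert (0 <= (x * z)^2) by apply pow2_ge_0; nra. }
assert (Hf : forall p, f p = (1 + x^2 * pz p ^ 2)^2).
{ intros p; unfold f, quartic; ring. }
assert (Hm := mean_pos x).
assert (Hlnsq : forall u, 0 < u -> ln (u^2) = 2 * ln u).
{ intros u Hu; replace (u^2) with (u * u) by ring; rewrite ln_mult; lra. }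
assert (Hmean : sphere_int f = mean x).
{ rewrite (sphere_int_zonal f (fun z => (1 + x^2 * z^2)^2)
    (fun z => z + 2 * x^2 * z^3 / 3 + x^4 * z^5 / 5)).
  - unfold mean; field.
  - intros p _; apply Hf.
  - intros z; auto_derive; [easy | field].
  - intros z; apply (ex_derive_continuous (K := R_AbsRing) (V := R_NormedModule)
      (fun z => (1 + x^2 * z^2)^2)); auto_derive; easy. }
(* The factor [(1 + x^2 z^2)^2] of [f] cancels the denominator of [h'^2], leaving a polynomial in
   [z]. *)
assert (Henergy : sphere_int
    (fun p => f p * dot (zonal_grad h' p) (zonal_grad h' p)) = 32/15 * x^4).
{ rewrite (sphere_int_zonal _ (fun z => 16 * x^4 * (z^2 - z^4))
    (fun z => 16 * x^4 * (z^3 / 3 - z^5 / 5))).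
  - field.
  - intros p Hp; rewrite zonal_grad_sq, Hf by exact Hp; unfold h'.
    specialize (Hw (pz p)); field; lra.
  - intros z; auto_derive; [easy | field].
  - intros z; apply (ex_derive_continuous (K := R_AbsRing) (V := R_NormedModule)
      (fun z => 16 * x^4 * (z^2 - z^4))); auto_derive; easy. }
(* The primitive comes from integrating by parts against [ln (1 + x^2 z^2)]. *)
assert (Hent : sphere_int (fun p => f p * ln (f p)) =
    2 * mean x * ln (1 + x^2)
    - 4 * (x^4 / 25 + 7 * x^2 / 45 + 8/15) + 32/15 * atan x / x).
{ rewrite (sphere_int_zonal _ (fun z => (1 + x^2 * z^2)^2 * (2 * ln (1 + x^2 * z^2)))
    (fun z => 2 * (z + 2 * x^2 * z^3 / 3 + x^4 * z^5 / 5) * ln (1 + x^2 * z^2)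
      - 4 * (x^4 * z^5 / 25 + 7 * x^2 * z^3 / 45 + 8 * z / 15)
      + 32/15 * atan (x * z) / x)).
  - replace (x * 1) with x by ring.
    replace (x * -1) with (- x) by ring; rewrite atan_opp.
    replace (1 + x^2 * 1^2) with (1 + x^2) by ring.
    replace (1 + x^2 * (-1)^2) with (1 + x^2) by ring.
    unfold mean; field; lra.
  - intros p _; rewrite Hf, Hlnsq by apply Hw; reflexivity.
  - intros z; specialize (Hw z).
    auto_derive; [simpl in Hw; repeat split; lra |].
    simpl; field; simpl in Hw; repeat split; nra.
  - intros z; specialize (Hw z).
    apply (ex_derive_continuous (K := R_AbsRing) (V := R_NormedModule)
      (fun z => (1 + x^2 * z^2)^2 * (2 * ln (1 + x^2 * z^2)))).
    auto_derive; simpl in Hw; lra. }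
assert (Hineq := Hc f (zonal_grad h')).
rewrite Henergy, Hent, Hmean in Hineq.
assert (Hlog : logratio x = 2 * ln (1 + x^2) - ln (mean x)).
{ unfold logratio; rewrite ln_div, Hlnsq; [reflexivity | nra | | exact Hm].
  apply pow_lt; nra. }
assert (HE : 15/16 * (2 * mean x * ln (1 + x^2)
    - 4 * (x^4 / 25 + 7 * x^2 / 45 + 8/15) + 32/15 * atan x / x
    - mean x * ln (mean x)) = entropy_num x / x).
{ unfold entropy_num; rewrite Hlog; field; lra. }
replace (c * entropy_num x) with (x * (c * (entropy_num x / x)))
  by (field; lra).
replace (x^5) with (x * x^4) by ring.
apply Rmult_le_compat_l; [lra |].
rewrite <- HE.
cut (32/15 * x^4 >= 2 * c * (2 * mean x * ln (1 + x^2)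
    - 4 * (x^4 / 25 + 7 * x^2 / 45 + 8/15) + 32/15 * atan x / x
    - mean x * ln (mean x))); [lra |].
apply Hineq.
- intros p _; exists (fun _ => True), f; repeat split.
  + apply open_true.
  + intros n; apply quartic_Cn.
- intros p _; rewrite Hf; apply pow_lt, Hw.
- intros p _; rewrite !Hf; unfold antipode, pz; simpl; ring.
- intros p Hp.
  replace (fun q => ln (f q)) with (fun q => (fun z => 2 * ln (1 + x^2 * z^2)) (pz q)).
  + apply (is_sphere_grad_zonal (fun z => 2 * ln (1 + x^2 * z^2))); [| exact Hp].
    specialize (Hw (pz p)); unfold h'.
    auto_derive; [simpl in Hw; lra | field; lra].
  + apply functional_extensionality; intros q.
    rewrite Hf, Hlnsq by apply Hw; reflexivity.
Qed.

(** * Return to the variable [t] and conclusion *)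

Lemma entropy_ratio_inv_sqrt (t : R) :
  0 < t ->
  2 * t ^ 2 * sqrt t * atan (1 / sqrt t)
  + 15 / 16 * (t ^ 2 + 2 * t / 3 + 1 / 5)
      * ln ((t ^ 2 + 2 * t + 1) / (t ^ 2 + 2 * t / 3 + 1 / 5))
  - (120 * t ^ 2 + 35 * t + 9) / 60
  = entropy_num (1 / sqrt t) / (1 / sqrt t) ^ 5.
Proof.
intros Ht.
assert (Hr : 0 < sqrt t) by (apply sqrt_lt_R0, Ht).
assert (Hrt : t = sqrt t ^ 2) by (rewrite pow2_sqrt; lra).
(* With [t = r^2] the claim becomes an identity of rational functions once the logarithms are
   matched. *)
revert Hr Hrt; generalize (sqrt t); intros r Hr ->.
unfold entropy_num, logratio, mean.
replace ((1 + (1 / r)^2)^2 / (1 + 2 * (1 / r)^2 / 3 + (1 / r)^4 / 5))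
  with (((r^2)^2 + 2 * r^2 + 1) / ((r^2)^2 + 2 * r^2 / 3 + 1 / 5)).
- field; lra.
- field; split; [lra | nra].
Qed.

Theorem theorem1p6 (alpha3 : R) (Halpha3 : is_largest log_sobolev alpha3) :
  exists m : R,
    is_minimum_on (fun t => 0 < t)
      (fun t =>
        / (2 * t ^ 2 * sqrt t * atan (1 / sqrt t)
           + 15 / 16 * (t ^ 2 + 2 * t / 3 + 1 / 5)
               * ln ((t ^ 2 + 2 * t + 1) / (t ^ 2 + 2 * t / 3 + 1 / 5))
           - (120 * t ^ 2 + 35 * t + 9) / 60))
      m /\
    alpha3 <= m /\
    5.8358 <= m < 5.8359.
Proof.
destruct entropy_ratio_max as [c [Hc [Hmax [Hlow Hup]]]].
assert (Hc5 : 0 < c^5) by (apply pow_lt, Hc).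
assert (HN := entropy_num_pos c Hc).
assert (Hratio : 0 < entropy_num c / c^5) by (apply Rdiv_lt_0_compat; lra).
(* The minimum is the reciprocal of the maximal ratio, attained at [t = 1 / c^2]; positivity of the
   ratio makes inversion reverse the order. *)
exists (/ (entropy_num c / c^5)); split; [split | split; [| split]].
- assert (Ht : 0 < (/ c)^2) by (apply pow_lt, Rinv_0_lt_compat, Hc).
  exists ((/ c)^2); split; [exact Ht |].
  rewrite (entropy_ratio_inv_sqrt _ Ht).
  replace (1 / sqrt ((/ c)^2)) with c; [reflexivity |].
  rewrite sqrt_pow2; [field; lra | apply Rlt_le, Rinv_0_lt_compat, Hc].
- intros t Ht; rewrite (entropy_ratio_inv_sqrt t Ht).
  assert (Hx : 0 < 1 / sqrt t)
    by (apply Rdiv_lt_0_compat; [lra | apply sqrt_lt_R0, Ht]).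
  apply Rinv_le_contravar; [| apply Hmax, Hx].
  apply Rdiv_lt_0_compat; [apply entropy_num_pos, Hx | apply pow_lt, Hx].
- assert (H := log_sobolev_entropy_num alpha3 c (proj1 Halpha3) Hc).
  replace (/ (entropy_num c / c^5)) with (c^5 / entropy_num c)
    by (field; split; lra).
  apply Rle_div_r; lra.
- rewrite <- (Rinv_inv 5.8358); apply Rinv_le_contravar; lra.
- rewrite <- (Rinv_inv 5.8359); apply Rinv_lt_contravar; [| exact Hlow].
  apply Rmult_lt_0_compat; lra.
Qed.
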